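(* Let $\{U_n\}_{n=0}^\infty$ be the sequence defined by $U_0=1$, $U_1=12$ and, for $n\ge 1$, $$U_{n+1}=\frac{3(2n+1)(3n^2+3n+1)(15n^2+15n+4)}{(n+1)^5}\,U_n+\frac{3n^3(3n-1)(3n+1)}{(n+1)^5}\,U_{n-1}.$$ The sequence $\{U_n\}_{n=0}^\infty$ is strictly 2-log-convex.
   Context: A positive sequence $\{a_n\}_{n=0}^\infty$ is log-convex if $a_n^2\le a_{n-1}a_{n+1}$ for all $n\ge 1$. It is 2-log-convex if it is log-convex and for all $n\ge 1$, $$\left(a_na_{n+2}-a_{n+1}^2\right)^2\le\left(a_{n-1}a_{n+1}-a_n^2\right)\left(a_{n+1}a_{n+3}-a_{n+2}^2\right).$$ It is strictly 2-log-convex if it is 2-log-convex and the latter inequality is strict for all $n\ge 1$. *)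

(* Defs.v *)
From mathcomp Require Import all_boot all_order all_algebra.

Set Implicit Arguments.
Unset Strict Implicit.
Unset Printing Implicit Defensive.

Import Order.TTheory GRing.Theory Num.Theory.
Local Open Scope ring_scope.

Definition positive_seq (R : realFieldType) (a : nat -> R) : Prop :=
  forall n : nat, 0 < a n.

Definition log_convex (R : realFieldType) (a : nat -> R) : Prop :=
  positive_seq a /\
  forall n : nat, (1 <= n)%N -> a n ^+ 2 <= a n.-1 * a n.+1.

Definition two_log_convex (R : realFieldType) (a : nat -> R) : Prop :=
  log_convex a /\
  forall n : nat, (1 <= n)%N ->
    (a n * a n.+2 - a n.+1 ^+ 2) ^+ 2
      <= (a n.-1 * a n.+1 - a n ^+ 2) * (a n.+1 * a n.+3 - a n.+2 ^+ 2).

(* Strictness concerns only the second-order inequality. *)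
Definition strictly_two_log_convex (R : realFieldType) (a : nat -> R) : Prop :=
  two_log_convex a /\
  forall n : nat, (1 <= n)%N ->
    (a n * a n.+2 - a n.+1 ^+ 2) ^+ 2
      < (a n.-1 * a n.+1 - a n ^+ 2) * (a n.+1 * a n.+3 - a n.+2 ^+ 2).

(* Main.v *)
Require Import Defs.
From Stdlib Require Import ZArith.
From mathcomp Require Import all_boot all_order all_algebra.
From mathcomp Require Import ssrZ ring lra realalg.

Set Implicit Arguments.
Unset Strict Implicit.
Unset Printing Implicit Defensive.

Import Order.TTheory GRing.Theory Num.Theory.
Local Open Scope ring_scope.

(** Write q_n = U_n / U_(n-1).  After division by powers of the terms,
    log-convexity says that q increases, and the second inequality reads
      q_n (q_(n+2) - q_(n+1))^2
        < (q_(n+1) - q_n) q_(n+2) (q_(n+3) - q_(n+2)).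
    Asymptotically q_n = alpha (1 - 5/(2n) + ...) with
    alpha = 135 + 78 sqrt 3, the positive root of alpha^2 = 270 alpha + 27, so
    the gaps of q behave like 675/n^2.  The right-hand side then exceeds the
    left-hand side by a factor 1 + 7/n^2 + ...: 2/n^2 comes from the second
    difference of -2 log n, and 5/n^2 from q_(n+2) / q_n.

    It therefore suffices to know q_n with an error that is a small multiple
    of n^-4.  The recurrence becomes q_(n+1) = a(n) + b(n) / q_n, whose map is
    decreasing and strongly contracting (b/q^2 is about 1/2700), so a pair of
    good approximate solutions encloses the true one by induction
    ([scaled_quotient_bounds]).  Such a pair, [lower] and [upper], comes from
    truncating the formal solution of the recurrence in powers of n - 1/2; its
    two leading terms must be exact, because an error there would perturb q_n
    by amounts of order 1 or n^-2, no smaller than the gaps.  This is where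
    sqrt 3 enters.  Replacing each q by its least favourable bound leaves
    polynomial inequalities in n ([lower_step], [upper_step], [gap_gt0],
    [extremal_gaps]).  After the substitution n = m + 1 the polynomials in m
    turn out to have only nonnegative coefficients a + b sqrt 3, which is
    checked by computation ([tval_ge0]); since this works from n = 1 on, no
    further initial terms have to be inspected separately.

    An arbitrary ordered field need not contain sqrt 3.  However U takes
    rational values, and the inequalities between them can be checked in any
    ordered field; they are proved in the field of real algebraic numbers and
    brought back through the rationals ([strictly_two_log_convex_ratr]). *)

(** * Certified nonnegativity of polynomials over Z[sqrt 3] *)

Section Certificates.

Variables (R : realDomainType) (s : R).
Hypotheses (s_ge0 : 0 <= s) (s_sqr : s ^+ 2 = 3%:R).

(** Binary integers, and lists of pairs of them for the polynomials, because
    the kernel has to compute the expansions below, of degree up to 24 and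
    with coefficients of up to 28 digits. *)
Definition zval (z : Z) : R := (int_of_Z z)%:~R.
Definition cval (c : Z * Z) : R := zval c.1 + zval c.2 * s.

Definition cadd (c d : Z * Z) := (c.1 + d.1, c.2 + d.2).
Definition cmul (c d : Z * Z) :=
  (c.1 * d.1 + 3%:R * (c.2 * d.2), c.1 * d.2 + c.2 * d.1).

(** For b < 0, the number a + b sqrt 3 is nonnegative as soon as a >= 0 and
    a^2 >= 3 b^2; this spares any rational approximation of sqrt 3. *)
Definition cnonneg (c : Z * Z) : bool :=
  Z.leb 0 c.1 && (Z.leb 0 c.2 || Z.leb (3%:R * (c.2 * c.2)) (c.1 * c.1)).

Fixpoint pval (p : seq (Z * Z)) (x : R) : R :=
  if p is c :: p' then cval c + x * pval p' x else 0.

Fixpoint padd (p q : seq (Z * Z)) :=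
  match p, q with
  | [::], _ => q
  | _, [::] => p
  | c :: p', d :: q' => cadd c d :: padd p' q'
  end.

Definition pscale (c : Z * Z) (p : seq (Z * Z)) := [seq cmul c d | d <- p].

Fixpoint pmul (p q : seq (Z * Z)) :=
  if p is c :: p' then padd (pscale c q) ((0, 0) :: pmul p' q) else [::].

Lemma zvalD a b : zval (a + b) = zval a + zval b.
Proof. by rewrite /zval !rmorphD. Qed.

Lemma zvalN a : zval (- a) = - zval a.
Proof. by rewrite /zval !rmorphN. Qed.

Lemma zvalM a b : zval (a * b) = zval a * zval b.
Proof. by rewrite /zval !rmorphM. Qed.

Lemma zval_nat k : zval k%:R = k%:R.
Proof. by rewrite /zval !rmorph_nat. Qed.

Lemma zval0 : zval 0 = 0.
Proof. exact: (zval_nat 0). Qed.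

Lemma zval_le a b : Z.leb a b -> zval a <= zval b.
Proof.
move=> /Z.leb_le /Z.le_0_sub le_ab; rewrite /zval ler_int -subr_ge0 -rmorphB /=.
by rewrite -[b - a]/(Z.sub b a); case: (Z.sub b a) le_ab.
Qed.

Lemma cvalD c d : cval (cadd c d) = cval c + cval d.
Proof. rewrite /cval !zvalD; ring. Qed.

Lemma cvalM c d : cval (cmul c d) = cval c * cval d.
Proof.
rewrite /cval !zvalD !zvalM zval_nat -s_sqr; ring.
Qed.

Lemma cval_ge0 c : cnonneg c -> 0 <= cval c.
Proof.
rewrite /cnonneg /cval; move: c.1 c.2 => a b.
move=> /andP[/zval_le]; rewrite zval0 => a_ge0 /orP[].
  by move=> /zval_le; rewrite zval0 => b_ge0; rewrite addr_ge0 // mulr_ge0.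
move=> /zval_le; rewrite !zvalM zval_nat -s_sqr => le_sqr.
have : `|zval b * s| <= `|zval a|.
  rewrite -ler_sqr ?nnegrE // !real_normK ?num_real //.
  by rewrite exprMn mulrC [zval b ^+ 2]expr2 [zval a ^+ 2]expr2.
by rewrite (ger0_norm a_ge0) ler_norml => /andP[? _]; rewrite -lerBlDl sub0r.
Qed.

Lemma pvalD p q x : pval (padd p q) x = pval p x + pval q x.
Proof.
elim: p q => [|c p IHp] [|d q] /=; rewrite ?add0r ?addr0 //.
rewrite IHp cvalD; ring.
Qed.

Lemma pval_scale c p x : pval (pscale c p) x = cval c * pval p x.
Proof.
elim: p => [|d p IHp] /=; first by rewrite mulr0.
rewrite IHp cvalM; ring.
Qed.

Lemma pvalM p q x : pval (pmul p q) x = pval p x * pval q x.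
Proof.
elim: p => [|c p IHp] /=; first by rewrite mul0r.
rewrite pvalD pval_scale /= IHp /cval /= zval0; ring.
Qed.

Lemma pval_ge0 p x : all cnonneg p -> 0 <= x -> 0 <= pval p x.
Proof.
move=> + x_ge0; elim: p => //= c p IHp /andP[/cval_ge0 c_ge0 /IHp p_ge0].
by rewrite addr_ge0 // mulr_ge0.
Qed.

(** Syntax of the expressions in one variable and sqrt 3, so that expansion
    into coefficients is a function that can be evaluated. *)
Inductive term :=
  | Var
  | Root
  | Cst of nat
  | Add of term & term
  | Opp of term
  | Mul of term & term
  | Exp of term & nat.

Fixpoint tval (t : term) (x : R) : R :=
  match t with
  | Var => x
  | Root => s
  | Cst k => k%:R
  | Add t1 t2 => tval t1 x + tval t2 x
  | Opp t1 => - tval t1 x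
  | Mul t1 t2 => tval t1 x * tval t2 x
  | Exp t1 k => tval t1 x ^+ k
  end.

Fixpoint expand (t : term) : seq (Z * Z) :=
  match t with
  | Var => [:: (0, 0); (1, 0)]
  | Root => [:: (0, 1)]
  | Cst k => [:: (k%:R, 0)]
  | Add t1 t2 => padd (expand t1) (expand t2)
  | Opp t1 => pscale (- 1, 0) (expand t1)
  | Mul t1 t2 => pmul (expand t1) (expand t2)
  | Exp t1 k => iter k (pmul (expand t1)) [:: (1, 0)]
  end.

Lemma expandP t x : tval t x = pval (expand t) x.
Proof.
have zval1 : zval 1 = 1 by exact: (zval_nat 1).
elim: t => /= [|| k | t1 -> t2 -> | t1 -> | t1 -> t2 -> | t1 -> k].
- by rewrite /cval /= zval0 zval1; ring.
- by rewrite /cval /= zval0 zval1; ring.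
- by rewrite /cval /= zval0 zval_nat; ring.
- by rewrite pvalD.
- by rewrite pval_scale /cval /= zvalN zval0 zval1; ring.
- by rewrite pvalM.
elim: k => [|k IHk] /=; first by rewrite /cval /= zval0 zval1 expr0; ring.
by rewrite pvalM exprS IHk.
Qed.

(** The reflection principle behind all the polynomial inequalities:
    a polynomial with nonnegative coefficients is nonnegative on the
    nonnegative half-line. *)
Lemma tval_ge0 t x : 0 <= x -> all cnonneg (expand t) -> 0 <= tval t x.
Proof. by move=> x_ge0 ?; rewrite expandP pval_ge0. Qed.

End Certificates.

Ltac reify s x e :=
  lazymatch e with
  | x => constr:(Var)
  | s => constr:(Root)
  | GRing.add ?a ?b =>
      let a' := reify s x a in let b' := reify s x b in constr:(Add a' b')
  | GRing.opp ?a => let a' := reify s x a in constr:(Opp a')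
  | GRing.mul ?a ?b =>
      let a' := reify s x a in let b' := reify s x b in constr:(Mul a' b')
  | GRing.exp ?a ?k => let a' := reify s x a in constr:(Exp a' k)
  | GRing.natmul (GRing.one _) ?k => constr:(Cst k)
  | GRing.one _ => constr:(Cst 1)
  end.

(** Solves [a <= b], for polynomial expressions a and b in x >= 0 and s, when
    every coefficient of b - a in Z[s] passes [cnonneg]. *)
Ltac nonneg_coefs s_ge0 s_sqr x_ge0 :=
  rewrite -subr_ge0;
  lazymatch type of s_ge0 with is_true (_ <= ?s) =>
  lazymatch type of x_ge0 with is_true (_ <= ?x) =>
  lazymatch goal with |- is_true (_ <= ?e) =>
    let t := reify s x e in
    exact: (@tval_ge0 _ s s_ge0 s_sqr t x x_ge0
              ltac:(vm_cast_no_check (erefl true)))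
  end end end.

(** * The recurrence and the enclosing polynomials *)

Definition coefA {K : realFieldType} (x : K) : K :=
  3%:R * (2%:R * x + 1) * (3%:R * x ^+ 2 + 3%:R * x + 1)
    * (15%:R * x ^+ 2 + 15%:R * x + 4%:R).

Definition coefB {K : realFieldType} (x : K) : K :=
  3%:R * x ^+ 3 * (3%:R * x - 1) * (3%:R * x + 1).

(** These polynomials enclose T_n = 384 n^5 q_n.  Solving the recurrence for T
    formally in decreasing powers of y = 2 n - 1 gives
      T_n = (1620 + 936 sqrt 3) y^5 + (648 + 377 sqrt 3) y^3 + 9 y^2
              + c y + O(1)
    with c close to 96; expanding around n = 1/2 removes the y^4 term, and 384
    clears the denominators.  The bounds replace c by 0 and 1000, a window of
    width about 5/n^4 for q_n. *)
Definition lower {K : realFieldType} (s x : K) : K :=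
  (1620%:R + 936%:R * s) * (2%:R * x - 1) ^+ 5
    + (648%:R + 377%:R * s) * (2%:R * x - 1) ^+ 3 + 9%:R * (2%:R * x - 1) ^+ 2.

Definition upper {K : realFieldType} (s x : K) : K :=
  lower s x + 1000%:R * (2%:R * x - 1).

Section Bounds.

Variables (R : realFieldType) (s : R).
Hypotheses (s_ge0 : 0 <= s) (s_sqr : s ^+ 2 = 3%:R).

Lemma shift1 x : 1 <= x -> exists2 m : R, 0 <= m & x = m + 1.
Proof. by move=> x_ge1; exists (x - 1); rewrite ?subr_ge0 // subrK. Qed.

Lemma lower_gt0 x : 1 <= x -> 0 < lower s x.
Proof.
(* Coefficients only certify weak inequalities; here the value is even >= 1. *)
move=> /shift1[m m_ge0 ->]; apply: lt_le_trans (ltr01) _; rewrite /lower.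
nonneg_coefs s_ge0 s_sqr m_ge0.
Qed.

(** The map t |-> 384 A + 384^2 n^5 B / t, which sends T_n to T_(n+1), is
    decreasing, so the lower bound at n yields the upper bound at n + 1 and
    conversely.  Both claims are multiplied out by the denominator. *)
Lemma upper_step x : 1 <= x ->
  384%:R * coefA x * lower s x + 384%:R ^+ 2 * x ^+ 5 * coefB x
    <= upper s (x + 1) * lower s x.
Proof.
move=> /shift1[m m_ge0 ->]; rewrite /coefA /coefB /upper /lower.
nonneg_coefs s_ge0 s_sqr m_ge0.
Qed.

Lemma lower_step x : 1 <= x ->
  lower s (x + 1) * upper s x
    <= 384%:R * coefA x * upper s x + 384%:R ^+ 2 * x ^+ 5 * coefB x.
Proof.
move=> /shift1[m m_ge0 ->]; rewrite /coefA /coefB /upper /lower.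
nonneg_coefs s_ge0 s_sqr m_ge0.
Qed.

(** Even the least favourable values in the enclosures make q increase: the
    gap of q is of order n^-2 whereas the enclosures have width of order
    n^-4. *)
Lemma gap_gt0 x : 1 <= x ->
  0 < lower s (x + 1) * x ^+ 5 - upper s x * (x + 1) ^+ 5.
Proof.
move=> /shift1[m m_ge0 ->]; apply: lt_le_trans (ltr01) _.
rewrite /upper /lower; nonneg_coefs s_ge0 s_sqr m_ge0.
Qed.

(** The second-order inequality for the least favourable choice in the four
    enclosures: q_n and the middle gap as large as possible, the outer gaps
    and q_(n+2) as small as possible.  The four values are treated as
    independent, which the margin 7/n^2 affords. *)
Lemma extremal_gaps x : 1 <= x ->
  upper s x * (x + 3%:R) ^+ 5
    * (upper s (x + 2%:R) * (x + 1) ^+ 5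
       - lower s (x + 1) * (x + 2%:R) ^+ 5) ^+ 2
  < (x + 1) ^+ 5 * (lower s (x + 1) * x ^+ 5 - upper s x * (x + 1) ^+ 5)
    * lower s (x + 2%:R)
    * (lower s (x + 3%:R) * (x + 2%:R) ^+ 5
       - upper s (x + 2%:R) * (x + 3%:R) ^+ 5).
Proof.
move=> /shift1[m m_ge0 ->]; rewrite -subr_gt0; apply: lt_le_trans (ltr01) _.
rewrite /upper /lower; nonneg_coefs s_ge0 s_sqr m_ge0.
Qed.

Lemma scaled_gap_ge x w0 w1 :
    1 <= x -> w0 <= upper s x -> lower s (x + 1) <= w1 ->
  lower s (x + 1) * x ^+ 5 - upper s x * (x + 1) ^+ 5
    <= w1 * x ^+ 5 - w0 * (x + 1) ^+ 5.
Proof.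
by move=> x_ge1 hi0 lo1; rewrite lerB // ler_wpM2r // exprn_ge0 //; lra.
Qed.

Lemma scaled_gap_gt0 x w0 w1 :
    1 <= x -> w0 <= upper s x -> lower s (x + 1) <= w1 ->
  0 < w1 * x ^+ 5 - w0 * (x + 1) ^+ 5.
Proof.
move=> x_ge1 hi0 lo1.
by apply: lt_le_trans (scaled_gap_ge x_ge1 hi0 lo1); apply: gap_gt0.
Qed.

(** Both sides are monotone in the gaps and in the outer factors, all of which
    are positive, so [extremal_gaps] is the worst case. *)
Lemma scaled_gaps_lt x w0 w1 w2 w3 : 1 <= x ->
    lower s x <= w0 <= upper s x ->
    lower s (x + 1) <= w1 <= upper s (x + 1) ->
    lower s (x + 2%:R) <= w2 <= upper s (x + 2%:R) ->
    lower s (x + 3%:R) <= w3 ->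
  w0 * (x + 3%:R) ^+ 5 * (w2 * (x + 1) ^+ 5 - w1 * (x + 2%:R) ^+ 5) ^+ 2
  < (x + 1) ^+ 5 * (w1 * x ^+ 5 - w0 * (x + 1) ^+ 5) * w2
    * (w3 * (x + 2%:R) ^+ 5 - w2 * (x + 3%:R) ^+ 5).
Proof.
move=> x_ge1 /andP[lo0 hi0] /andP[lo1 hi1] /andP[lo2 hi2] lo3.
have pow_ge0 (k : R) : 0 <= k -> 0 <= (x + k) ^+ 5.
  by move=> k_ge0; rewrite exprn_ge0 //; lra.
have E2 : x + 2%:R = x + 1 + 1 by ring.
have E3 : x + 3%:R = x + 2%:R + 1 by ring.
have x1_ge1 : 1 <= x + 1 by lra.
have x2_ge1 : 1 <= x + 2%:R by lra.
have lo2_gt0 := lower_gt0 x2_ge1.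
have mid_gt0 : 0 < w2 * (x + 1) ^+ 5 - w1 * (x + 2%:R) ^+ 5.
  by rewrite E2; apply: scaled_gap_gt0; rewrite -?E2.
have first_gt0 := gap_gt0 x_ge1.
have first_ge := scaled_gap_ge x_ge1 hi0 lo1.
have last_gt0 : 0 < lower s (x + 3%:R) * (x + 2%:R) ^+ 5
                    - upper s (x + 2%:R) * (x + 3%:R) ^+ 5.
  by rewrite E3; apply: gap_gt0.
have last_ge : lower s (x + 3%:R) * (x + 2%:R) ^+ 5
                 - upper s (x + 2%:R) * (x + 3%:R) ^+ 5
               <= w3 * (x + 2%:R) ^+ 5 - w2 * (x + 3%:R) ^+ 5.
  by rewrite E3 in lo3 *; apply: scaled_gap_ge.
apply: (le_lt_trans _ (lt_le_trans (extremal_gaps x_ge1) _)).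
  apply: ler_pM; last rewrite ler_sqr ?nnegrE.
  - by rewrite mulr_ge0 ?pow_ge0 // (le_trans (ltW (lower_gt0 x_ge1))).
  - exact: sqr_ge0.
  - by rewrite ler_wpM2r ?pow_ge0.
  - by rewrite lerB // ler_wpM2r // pow_ge0.
  - exact: ltW.
  - by apply: le_trans (ltW mid_gt0) _; rewrite lerB // ler_wpM2r // pow_ge0.
have N1_ge0 : 0 <= (x + 1) ^+ 5 by exact: pow_ge0.
apply: ler_pM => //; [|exact: ltW|].
  by apply: mulr_ge0 (ltW lo2_gt0); apply: mulr_ge0 => //; apply: ltW.
apply: ler_pM => //; [|exact: ltW|exact: ler_wpM2l].
by apply: mulr_ge0 => //; apply: ltW.
Qed.

End Bounds.

(** * From the quotients to the sequence *)

Definition satisfies_recurrence {K : realFieldType} (U : nat -> K) : Prop :=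
  forall n : nat, (1 <= n)%N ->
    U n.+1 = coefA n%:R / (n%:R + 1) ^+ 5 * U n
             + coefB n%:R / (n%:R + 1) ^+ 5 * U n.-1.

Lemma coefA_gt0 (K : realFieldType) (x : K) : 1 <= x -> 0 < coefA x.
Proof.
by move=> x_ge1; rewrite /coefA !(mulr_gt0, addr_gt0) ?exprn_gt0 //; lra.
Qed.

Lemma coefB_gt0 (K : realFieldType) (x : K) : 1 <= x -> 0 < coefB x.
Proof. by move=> x_ge1; rewrite /coefB !mulr_gt0 ?exprn_gt0 //; lra. Qed.

(** In the two identities below v, v q_0, v q_0 q_1, ... are consecutive terms
    of a sequence whose quotients are q_i = w_i / (c N_i); in the application
    c = 384 and N_i = (n + i)^5.  They exhibit the log-convexity defect and
    the second-order defect as positive multiples of the expressions bounded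
    in [gap_gt0] and [extremal_gaps]. *)
Lemma log_convex_defectE (K : fieldType) (v c w0 w1 N0 N1 : K) :
    c != 0 -> N0 != 0 -> N1 != 0 ->
  v * (v * (w0 / (c * N0)) * (w1 / (c * N1))) - (v * (w0 / (c * N0))) ^+ 2
  = v ^+ 2 * w0 / (c ^+ 2 * N0 ^+ 2 * N1) * (w1 * N0 - w0 * N1).
Proof. by move=> c0 N00 N10; field; rewrite c0 N00 N10. Qed.

Lemma two_log_convex_defectE (K : fieldType)
    (v c w0 w1 w2 w3 N0 N1 N2 N3 : K) :
    c != 0 -> N0 != 0 -> N1 != 0 -> N2 != 0 -> N3 != 0 ->
  let u1 := v * (w0 / (c * N0)) in let u2 := u1 * (w1 / (c * N1)) in
  let u3 := u2 * (w2 / (c * N2)) in let u4 := u3 * (w3 / (c * N3)) in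
  (v * u2 - u1 ^+ 2) * (u2 * u4 - u3 ^+ 2) - (u1 * u3 - u2 ^+ 2) ^+ 2
  = v ^+ 4 * w0 ^+ 3 * w1 ^+ 2
      / (c ^+ 8 * N0 ^+ 4 * N1 ^+ 4 * N2 ^+ 2 * N3)
      * (N1 * (w1 * N0 - w0 * N1) * w2 * (w3 * N2 - w2 * N3)
         - w0 * N3 * (w2 * N1 - w1 * N2) ^+ 2).
Proof.
by move=> c0 N00 N10 N20 N30 /=; field; rewrite c0 N00 N10 N20 N30.
Qed.

Section Quotients.

Variables (R : realFieldType) (s : R) (U : nat -> R).
Hypotheses (s_ge0 : 0 <= s) (s_sqr : s ^+ 2 = 3%:R).
Hypotheses (U0 : U 0%N = 1) (U1 : U 1%N = 12%:R).
Hypothesis Urec : satisfies_recurrence U.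

Let nat_ge1 n : (1 <= n)%N -> 1 <= n%:R :> R.
Proof. by rewrite -[1]/(1%:R) ler_nat. Qed.

Lemma recurrence_pos : positive_seq U.
Proof.
have pos2 n : 0 < U n /\ 0 < U n.+1.
  elim: n => [|n [Un_gt0 UnS_gt0]]; first by rewrite U0 U1; split; lra.
  have den_gt0 : 0 < (n.+1%:R + 1 : R) ^+ 5 by rewrite exprn_gt0 // addr_gt0.
  have x_ge1 : 1 <= n.+1%:R :> R by exact: nat_ge1.
  split=> //; rewrite Urec //=; apply: addr_gt0; apply: mulr_gt0 => //.
    by apply: divr_gt0 => //; apply: coefA_gt0.
  by apply: divr_gt0 => //; apply: coefB_gt0.
by move=> n; case: (pos2 n).
Qed.

Definition scaled_quotient (n : nat) : R := 384%:R * n%:R ^+ 5 * (U n / U n.-1).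

Lemma scaled_quotientS n : (1 <= n)%N ->
  scaled_quotient n.+1
    = 384%:R * coefA n%:R
      + 384%:R ^+ 2 * n%:R ^+ 5 * coefB n%:R / scaled_quotient n.
Proof.
move=> n_gt0; rewrite /scaled_quotient Urec //= -[n.+1%:R]natr1.
have x_ge1 := nat_ge1 n_gt0; move: (n%:R) x_ge1 => x x_ge1.
have x_neq0 : x != 0 by lra.
have x1_neq0 : x + 1 != 0 by lra.
have := recurrence_pos n; have := recurrence_pos n.-1.
move=> /lt0r_neq0 Up_neq0 /lt0r_neq0 Un_neq0.
move: (coefA x) (coefB x) => a b.
by field; rewrite Up_neq0 Un_neq0 x_neq0 x1_neq0.
Qed.

Lemma scaled_quotient_bounds n : (1 <= n)%N ->
  lower s n%:R <= scaled_quotient n <= upper s n%:R.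
Proof.
elim: n => // -[_ _ | n IHn _].
  rewrite /scaled_quotient /= U0 U1 /upper /lower.
  (* At n = 1 the bounds need 1331/1313 <= s <= 2331/1313; both follow from
     7/4 being close to sqrt 3. *)
  have := sqr_ge0 (s - 7%:R / 4%:R); rewrite sqrrB s_sqr => s_near.
  have s_le : s <= 7%:R / 4%:R by lra.
  have := ler_wpM2l s_ge0 s_le; rewrite -expr2 s_sqr => s_ge.
  have -> : 2%:R * 1%:R - 1 = 1 :> R by ring.
  by rewrite !expr1n !mulr1 divr1; apply/andP; split; lra.
have x_ge1 : 1 <= n.+1%:R :> R by exact: nat_ge1.
have /andP[lo hi] := IHn isT.
have lo_gt0 := lower_gt0 s_ge0 s_sqr x_ge1.
have T_gt0 := lt_le_trans lo_gt0 lo.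
have hi_gt0 := lt_le_trans T_gt0 hi.
rewrite scaled_quotientS // -[n.+2%:R]natr1.
have c_ge0 : 0 <= 384%:R ^+ 2 * n.+1%:R ^+ 5 * coefB n.+1%:R :> R.
  by apply: mulr_ge0; rewrite ?(ltW (coefB_gt0 x_ge1)) // mulr_ge0 ?exprn_ge0.
have := upper_step s_ge0 s_sqr x_ge1.
have := lower_step s_ge0 s_sqr x_ge1.
move: (384%:R ^+ 2 * _ * _) (384%:R * coefA _) c_ge0 => c a c_ge0 lower_ok upper_ok.
apply/andP; split.
  apply: (@le_trans _ _ (a + c / upper s n.+1%:R)).
    by rewrite -(ler_pM2r hi_gt0) [(a + _) * _]mulrDl divfK ?gt_eqF.
  by rewrite lerD2l ler_wpM2l // lef_pV2.
apply: (@le_trans _ _ (a + c / lower s n.+1%:R)).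
  by rewrite lerD2l ler_wpM2l // lef_pV2.
by rewrite -(ler_pM2r lo_gt0) [(a + _) * _]mulrDl divfK ?gt_eqF.
Qed.

Lemma scaled_quotient_step n :
  U n.+1 = U n * (scaled_quotient n.+1 / (384%:R * n.+1%:R ^+ 5)).
Proof.
rewrite /scaled_quotient /=; have /lt0r_neq0 Un_neq0 := recurrence_pos n.
have : n.+1%:R != 0 :> R by rewrite pnatr_eq0.
by move: (n.+1%:R) => x x_neq0; field; rewrite Un_neq0 x_neq0.
Qed.

Lemma recurrence_strictly_two_log_convex : strictly_two_log_convex U.
Proof.
have Tb n k : (1 <= n)%N ->
    lower s (n%:R + k%:R) <= scaled_quotient (k + n) <= upper s (n%:R + k%:R).
  move=> n_gt0; rewrite -natrD [(k + n)%N]addnC.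
  by rewrite scaled_quotient_bounds ?addn_gt0 ?n_gt0.
have T_gt0 n k : (1 <= n)%N -> 0 < scaled_quotient (k + n).
  move=> n_gt0; have /andP[lo _] := Tb n k n_gt0; apply: lt_le_trans lo.
  by apply: (lower_gt0 s_ge0 s_sqr); rewrite -natrD nat_ge1 // addn_gt0 n_gt0.
have strict n : (1 <= n)%N ->
    U n ^+ 2 < U n.-1 * U n.+1 /\
    (U n * U n.+2 - U n.+1 ^+ 2) ^+ 2
      < (U n.-1 * U n.+1 - U n ^+ 2) * (U n.+1 * U n.+3 - U n.+2 ^+ 2).
  case: n => // p _; rewrite succnK.
  have n_gt0 : (1 <= p.+1)%N by [].
  have x_ge1 := nat_ge1 n_gt0.
  have b0 := Tb _ 0 n_gt0; have b1 := Tb _ 1 n_gt0.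
  have b2 := Tb _ 2 n_gt0; have b3 := Tb _ 3 n_gt0.
  rewrite addr0 !addSn add0n in b0 b1 b2 b3.
  have w0_gt0 := T_gt0 _ 0 n_gt0; have w1_gt0 := T_gt0 _ 1 n_gt0.
  rewrite !addSn add0n in w0_gt0 w1_gt0.
  have gap1 : 0 < scaled_quotient p.+2 * p.+1%:R ^+ 5
                  - scaled_quotient p.+1 * (p.+1%:R + 1) ^+ 5.
    by apply: (scaled_gap_gt0 s_ge0 s_sqr x_ge1); [case/andP: b0 | case/andP: b1].
  have gap2 := scaled_gaps_lt s_ge0 s_sqr x_ge1 b0 b1 b2 (proj1 (andP b3)).
  have v_gt0 := recurrence_pos p.
  rewrite !scaled_quotient_step.
  have -> : p.+2%:R = p.+1%:R + 1 :> R by rewrite natr1.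
  have -> : p.+3%:R = p.+1%:R + 2%:R :> R by rewrite -natrD addn2.
  have -> : p.+4%:R = p.+1%:R + 3%:R :> R by rewrite -natrD addn3.
  move: (U p) (p.+1%:R) x_ge1 v_gt0 w0_gt0 w1_gt0 gap1 gap2 {b0 b1 b2 b3} => v x.
  move: (scaled_quotient p.+1) (scaled_quotient p.+2) => w0 w1.
  move: (scaled_quotient p.+3) (scaled_quotient p.+4) => w2 w3.
  move=> x_ge1 v_gt0 w0_gt0 w1_gt0 gap1 gap2.
  have c_gt0 : 0 < 384%:R :> R by rewrite ltr0n.
  have pow_gt0 k : 0 <= k -> 0 < (x + k) ^+ 5.
    by move=> k_ge0; rewrite exprn_gt0 //; lra.
  have N0_gt0 : 0 < x ^+ 5 by rewrite exprn_gt0 //; lra.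
  have N1_gt0 := pow_gt0 1 ler01.
  have N2_gt0 := pow_gt0 2%:R (ler0n _ _).
  have N3_gt0 := pow_gt0 3%:R (ler0n _ _).
  rewrite -subr_gt0 in gap2; move: N0_gt0 N1_gt0 N2_gt0 N3_gt0 gap1 gap2.
  move: (384%:R) c_gt0 => c c_gt0.
  move: (x ^+ 5) ((x + 1) ^+ 5) ((x + 2%:R) ^+ 5) ((x + 3%:R) ^+ 5).
  move=> N0 N1 N2 N3 N0_gt0 N1_gt0 N2_gt0 N3_gt0 gap1 gap2.
  split; rewrite -subr_gt0.
    rewrite log_convex_defectE ?gt_eqF //.
    by rewrite mulr_gt0 // divr_gt0 // !mulr_gt0 // !exprn_gt0.
  rewrite two_log_convex_defectE ?gt_eqF //.
  by rewrite mulr_gt0 // divr_gt0 // !mulr_gt0 // !exprn_gt0.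
split; last by move=> n /strict[].
split; last by move=> n /strict[_ /ltW].
by split=> [|n /strict[/ltW]] //; exact: recurrence_pos.
Qed.

End Quotients.

(** * Descent to an arbitrary ordered field *)

Lemma recurrence_unique (K : realFieldType) (U V : nat -> K) :
    satisfies_recurrence U -> satisfies_recurrence V ->
  U 0%N = V 0%N -> U 1%N = V 1%N -> U =1 V.
Proof.
move=> Urec Vrec eq0 eq1 n.
suff [] : U n = V n /\ U n.+1 = V n.+1 by [].
elim: n => [//|n [eqn eqSn]]; split=> //.
by rewrite Urec // Vrec //= eqn eqSn.
Qed.

(** Two consecutive terms are carried along because the recurrence has order
    two. *)
Fixpoint rational_pair (n : nat) : rat * rat :=
  if n is k.+1 then
    let: (x, y) := rational_pair k in
    (y, coefA n%:R / (n%:R + 1) ^+ 5 * y + coefB n%:R / (n%:R + 1) ^+ 5 * x)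
  else (1, 12%:R).

Definition rational_solution (n : nat) : rat := (rational_pair n).1.

Lemma rational_solution_rec : satisfies_recurrence rational_solution.
Proof.
case=> // n _; rewrite /rational_solution /=.
by case: (rational_pair n).
Qed.

Lemma ratr_solution_rec (K : realFieldType) :
  satisfies_recurrence (fun n => ratr (rational_solution n) : K).
Proof.
move=> n n_gt0; rewrite rational_solution_rec //.
have coefA_ratr x : ratr (coefA x) = coefA (ratr x) :> K.
  have quad a b c : ratr (a%:R * x ^+ 2 + b%:R * x + c%:R)
      = a%:R * ratr x ^+ 2 + b%:R * ratr x + c%:R :> K.
    by rewrite !rmorphD !rmorphM /= !ratr_nat.
  have lin : ratr (2%:R * x + 1) = 2%:R * ratr x + 1 :> K.
    by rewrite rmorphD rmorphM /= ratr_nat rmorph1.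
  by rewrite /coefA 3!rmorphM /= lin (quad 3 3 1) (quad 15 15 4) ratr_nat.
have coefB_ratr x : ratr (coefB x) = coefB (ratr x) :> K.
  by rewrite /coefB !(rmorphM, rmorphD, rmorphN, rmorphXn, rmorph1, rmorph_nat).
have step_ratr a b d y z :
    ratr (a / d ^+ 5 * y + b / d ^+ 5 * z)
    = ratr a / ratr d ^+ 5 * ratr y + ratr b / ratr d ^+ 5 * ratr z :> K.
  by rewrite rmorphD !rmorphM fmorphV rmorphXn.
rewrite step_ratr coefA_ratr coefB_ratr [ratr (_ + 1)]rmorphD /=.
by rewrite rmorph1 !ratr_nat.
Qed.

(** The embedding of the rationals preserves and reflects the order, so the
    property can be moved between any two ordered fields through rat. *)
Lemma strictly_two_log_convex_ratr (K : realFieldType) (U : nat -> K)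
    (V : nat -> rat) : (forall n, U n = ratr (V n)) ->
  strictly_two_log_convex U <-> strictly_two_log_convex V.
Proof.
move=> UV.
have pos n : (0 < U n) = (0 < V n) by rewrite UV ltr0q.
have cvx n : (U n ^+ 2 <= U n.-1 * U n.+1) = (V n ^+ 2 <= V n.-1 * V n.+1).
  by rewrite !UV -!rmorphXn -!rmorphM ler_rat.
have lhs n : (U n * U n.+2 - U n.+1 ^+ 2) ^+ 2
    = ratr ((V n * V n.+2 - V n.+1 ^+ 2) ^+ 2).
  by rewrite !UV !(rmorphXn, rmorphB, rmorphM).
have rhs n :
    (U n.-1 * U n.+1 - U n ^+ 2) * (U n.+1 * U n.+3 - U n.+2 ^+ 2)
    = ratr ((V n.-1 * V n.+1 - V n ^+ 2) * (V n.+1 * V n.+3 - V n.+2 ^+ 2)).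
  by rewrite !UV !(rmorphXn, rmorphB, rmorphM).
split=> -[[[U_gt0 U_cvx] U_le] U_lt]; do 3?split.
- by move=> n; rewrite -pos.
- by move=> n /U_cvx; rewrite cvx.
- by move=> n /U_le; rewrite lhs rhs ler_rat.
- by move=> n /U_lt; rewrite lhs rhs ltr_rat.
- by move=> n; rewrite pos.
- by move=> n /U_cvx; rewrite cvx.
- by move=> n /U_le; rewrite lhs rhs ler_rat.
- by move=> n /U_lt; rewrite lhs rhs ltr_rat.
Qed.

Lemma rational_solution_strictly_two_log_convex :
  strictly_two_log_convex rational_solution.
Proof.
pose s : realalg := Num.sqrt 3%:R.
apply/(@strictly_two_log_convex_ratr realalg _ _ (fun=> erefl)).
apply: (@recurrence_strictly_two_log_convex _ s).
- exact: sqrtr_ge0.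
- by rewrite sqr_sqrtr ?ler0n.
- exact: rmorph1.
- exact: rmorph_nat.
- exact: ratr_solution_rec.
Qed.

Theorem theorem5p3 (R : realFieldType) (U : nat -> R)
  (U0 : U 0%N = 1) (U1 : U 1%N = 12%:R)
  (Urec : forall n : nat, (1 <= n)%N ->
    U n.+1 =
      3%:R * (2%:R * n%:R + 1) * (3%:R * n%:R ^+ 2 + 3%:R * n%:R + 1)
        * (15%:R * n%:R ^+ 2 + 15%:R * n%:R + 4%:R)
        / (n%:R + 1) ^+ 5 * U n
      + 3%:R * n%:R ^+ 3 * (3%:R * n%:R - 1) * (3%:R * n%:R + 1)
        / (n%:R + 1) ^+ 5 * U n.-1) :
  strictly_two_log_convex U.
Proof.
have U_ratr : forall n, U n = ratr (rational_solution n).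
  apply: recurrence_unique; first exact: Urec.
  - exact: ratr_solution_rec.
  - by rewrite U0 rmorph1.
  - by rewrite U1 rmorph_nat.
apply/(strictly_two_log_convex_ratr U_ratr).
exact: rational_solution_strictly_two_log_convex.
Qed.
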